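(* Let $G$ be a Henneberg I graph with $n\ge 3$ vertices. (1) For a generic choice of edge lengths for which $G$ is realizable in $\mathbb{R}^2$, the framework has at most $2^{n-2}$ embeddings in $\mathbb{R}^2$ up to rigid motions. (2) There exists a choice of edge lengths for $G$ such that the resulting framework has exactly $2^{n-2}$ embeddings in $\mathbb{R}^2$ up to rigid motions.
   Context: A Henneberg I graph is a graph obtained from a triangle by a (possibly empty) sequence of Henneberg steps of type I; a Henneberg step of type I adds one new vertex and two new edges connecting this vertex to two arbitrary distinct vertices of the previously constructed graph. A framework $(G,L)$ is a graph $G=(V,E)$, $V=\{1,\dots,n\}$, together with a set $L=\{l_{ij} : ij\in E\}$ of positive real numbers (edge lengths). An embedding (or realization) of $(G,L)$ in $\mathbb{R}^d$ is a map $V\to\mathbb{R}^d$, $i\mapsto p_i$, with $|p_i-p_j|=l_{ij}$ for every $ij\in E$; vertices may coincide and edges may cross. The framework is realizable if it has at least one embedding. Two embeddings are identified up to rigid motions if one is obtained from the other by an orientation-preserving isometry of $\mathbb{R}^d$ (so an embedding and its mirror image are counted as distinct unless related by such an isometry). ''For a generic choice of edge lengths'' means: there is a proper algebraic subset $Z\subset\mathbb{R}^{E}$ (depending on $G$) such that the assertion holds for all positive edge lengths $l_{ij}$ whose vector of squares $(l_{ij}^2)_{ij\in E}$ does not lie in $Z$. *)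

(* Defs.v *)
From mathcomp Require Import all_boot all_order all_algebra.
From mathcomp Require Import boolp classical_sets functions cardinality reals.
From mathcomp Require mpoly.

Set Implicit Arguments.
Unset Strict Implicit.
Unset Printing Implicit Defensive.

Import Order.TTheory GRing.Theory Num.Theory.

Local Open Scope ring_scope.
Local Open Scope classical_set_scope.

(* The indices are the vertex set and the edge set; an edge is the unordered
   pair of its endpoints.  The vertices of a graph under construction form a
   subset of a fixed finite type, so the class is closed under relabelling. *)
Inductive henneberg1 (V : finType) : {set V} -> {set {set V}} -> Prop :=
| henneberg1_triangle (a b c : V) of a != b & b != c & a != c :
    henneberg1 [set a; b; c]%SET
               [set [set a; b]; [set b; c]; [set a; c]]%SET
| henneberg1_step (W : {set V}) (E : {set {set V}}) (x a b : V) of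
    henneberg1 W E & x \notin W & a \in W & b \in W & a != b :
    henneberg1 (x |: W)%SET ([set x; a] |: ([set x; b] |: E))%SET.

Section Frameworks.
Variable R : realType.

(* Euclidean norm; the library norm on matrices is the sup norm. *)
Definition enorm d (v : 'rV[R]_d) : R := Num.sqrt (\sum_(k < d) v 0 k ^+ 2).

Definition euclidean_isometry d (f : 'rV[R]_d -> 'rV[R]_d) : Prop :=
  forall x y, enorm (f x - f y) = enorm (x - y).

(* Isometries of R^d are affine; orientation is read off the linear part. *)
Definition orientation_preserving d (f : 'rV[R]_d -> 'rV[R]_d) : Prop :=
  exists (A : 'M[R]_d) (b : 'rV[R]_d),
    (forall x, f x = x *m A + b) /\ 0 < \det A.

Definition rigid_motion d (f : 'rV[R]_d -> 'rV[R]_d) : Prop :=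
  euclidean_isometry f /\ orientation_preserving f.

Section Graph.
Variables (V : finType) (E : {set {set V}}).

(* Lengths are functions on all sets of vertices, but only their values on E
   are ever used. *)
Definition positive_lengths (l : {set V} -> R) : Prop :=
  forall e, e \in E -> 0 < l e.

Definition embeddings d (l : {set V} -> R) : set (V -> 'rV[R]_d) :=
  [set p | forall i j, [set i; j]%SET \in E ->
                       enorm (p i - p j) = l [set i; j]%SET].

Definition realizable d (l : {set V} -> R) : Prop :=
  exists p, @embeddings d l p.

Definition congruence_class d (p : V -> 'rV[R]_d) : set (V -> 'rV[R]_d) :=
  [set q | exists f, rigid_motion f /\ q = f \o p].

Definition embeddings_mod_rigid d (l : {set V} -> R) :
    set (set (V -> 'rV[R]_d)) :=
  (@congruence_class d) @` @embeddings d l.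

(* R^E is 'I_#|E| -> R, through the enumeration of E. *)
Definition squared_lengths (l : {set V} -> R) : 'I_#|E| -> R :=
  fun k => l (enum_val k) ^+ 2.

End Graph.

Arguments squared_lengths {V} E l _.

Definition algebraic_set k (Z : set ('I_k -> R)) : Prop :=
  exists S : set (mpoly.mpoly k R),
    Z = [set x | forall p, S p -> mpoly.meval x p = 0].

Definition generically (V : finType) (E : {set {set V}})
    (Q : ({set V} -> R) -> Prop) : Prop :=
  exists Z : set ('I_#|E| -> R),
    [/\ algebraic_set Z, Z <> setT &
        forall l, positive_lengths E l -> ~ Z (squared_lengths E l) -> Q l].

End Frameworks.

Arguments embeddings {R V} E d l _.
Arguments realizable {R V} E d l.
Arguments embeddings_mod_rigid {R V} E d l _.

(* Main.v *)
Require Import Defs.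
From mathcomp Require Import all_boot all_order all_algebra.
From mathcomp Require Import boolp classical_sets functions cardinality reals.
From mathcomp Require Import ring lra.
From mathcomp Require mpoly.
Import (canonicals) mpoly.

(** Every rigid-motion class of embeddings has exactly one representative that
    is pinned along a chosen edge [a b]: [a] sits at the origin and [b] on the
    positive first axis.  This follows from the existence of a rotation carrying
    a given segment to the axis ([rigid_motion_to_axis]) and from the fact that
    an orientation-preserving isometry fixing two points of the plane is the
    identity ([rigid_motion_fix_axis]).  So classes can be counted as pinned
    embeddings ([embeddings_mod_rigid_pinned], [congruence_class_pinned_inj]).

    A triangle is a type I step performed on a single edge, so a Henneberg I
    graph on [n] vertices arises from one edge by [n - 2] steps
    ([henneberg1_edge_built]).  The single edge has one pinned embedding, and a
    step joining [x] to [c] and [d] extends an embedding [q] by the choice of an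
    intersection point of two circles centred at [q c] and [q d]
    ([pinned_step]).  It remains to see when there are at most two, and when there
    are exactly two, such points for every [q].

    Upper bound: two circles with distinct centres meet in at most two points,
    and the centres can coincide only when the two new edges have equal length.
    Hence it is enough that the lengths be pairwise distinct ([pinned_le]), and
    this holds when the vector of squared lengths is off the zero set of the
    product of all the differences of coordinates ([generically_injective]).

    Sharpness: the two new edges are given the same length, larger than a bound
    [D] on all the distances between earlier vertices in all embeddings.  Two
    circles of equal radius exceeding half the distance of their distinct
    centres meet in exactly two points, and the new vertex lies too far from [c]
    to coincide with an earlier vertex, so distinct vertices stay apart and the
    construction can be repeated ([exists_exact_lengths]). *)

Set Implicit Arguments.
Unset Strict Implicit.
Unset Printing Implicit Defensive.

Import Order.TTheory GRing.Theory Num.Theory.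

Local Open Scope ring_scope.
Local Open Scope classical_set_scope.
Local Open Scope card_scope.

(** * Euclidean geometry of the plane *)

Section EuclideanPlane.
Variable R : realType.
Implicit Types (u v w y : 'rV[R]_2) (r s : R).

Lemma enorm_ge0 d (v : 'rV[R]_d) : 0 <= enorm v.
Proof. exact: sqrtr_ge0. Qed.

Lemma enormB d (u v : 'rV[R]_d) : enorm (u - v) = enorm (v - u).
Proof.
by congr Num.sqrt; apply: eq_bigr => k _; rewrite !mxE -sqrrN opprB.
Qed.

Lemma enorm0 d : enorm (0 : 'rV[R]_d) = 0.
Proof.
by rewrite /enorm big1 ?sqrtr0 // => k _; rewrite mxE expr0n.
Qed.

Lemma enorm_eq0 d (v : 'rV[R]_d) : enorm v = 0 -> v = 0.
Proof.
move/eqP; rewrite sqrtr_eq0 => le0; apply/rowP => k; rewrite mxE.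
have sq_ge0 (i : 'I_d) : true -> 0 <= v 0 i ^+ 2 by rewrite sqr_ge0.
have /eqP : \sum_(i < d) v 0 i ^+ 2 = 0.
  by apply/eqP; rewrite eq_le le0 sumr_ge0.
rewrite psumr_eq0 // => /allP/(_ k (mem_index_enum k)).
by rewrite sqrf_eq0 => /eqP.
Qed.

Lemma enorm_gt0 d (u v : 'rV[R]_d) : (0 < enorm (u - v)) = (u != v).
Proof.
rewrite lt_def enorm_ge0 andbT; congr (~~ _).
by apply/eqP/eqP => [/enorm_eq0/subr0_eq // | ->]; rewrite subrr enorm0.
Qed.

Lemma ord2P (i : 'I_2) : i = 0 \/ i = 1.
Proof. by case: i => -[|[|//]] lt; [left | right]; apply/val_inj. Qed.

Lemma sum_ord2 (F : 'I_2 -> R) : \sum_i F i = F 0 + F 1.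
Proof. by rewrite big_ord_recl big_ord1; congr (_ + F _); apply/val_inj. Qed.

Lemma sqr_enorm2 v : enorm v ^+ 2 = v 0 0 ^+ 2 + v 0 1 ^+ 2.
Proof.
by rewrite sqr_sqrtr ?sum_ord2 // addr_ge0 ?sqr_ge0.
Qed.

Lemma row2P u v : u 0 0 = v 0 0 -> u 0 1 = v 0 1 -> u = v.
Proof.
by move=> e0 e1; apply/rowP => k; case: (ord2P k) => ->.
Qed.

Lemma eq_enorm2 v r : 0 <= r -> enorm v ^+ 2 = r ^+ 2 -> enorm v = r.
Proof. by move=> r_ge0 /eqP; rewrite eqrXn2 ?enorm_ge0 // => /eqP. Qed.

Lemma enorm2_triangle u v : enorm (u + v) <= enorm u + enorm v.
Proof.
have := sqr_enorm2 u; have := sqr_enorm2 v; have := sqr_enorm2 (u + v).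
rewrite !mxE; move: (enorm_ge0 u) (enorm_ge0 v) (enorm_ge0 (u + v)).
move: (enorm u) (enorm v) (enorm (u + v)) => a b c.
set x := u 0 0; set y := u 0 1; set z := v 0 0; set t := v 0 1.
move=> a0 b0 c0 ec eb ea.
(* Cauchy-Schwarz, from Lagrange's identity *)
have cs : x * z + y * t <= a * b.
  have [neg|pos] := lerP (x * z + y * t) 0.
    by apply: (le_trans neg); exact: mulr_ge0.
  rewrite -(@ler_pXn2r _ 2) ?nnegrE ?mulr_ge0 ?(ltW pos) // exprMn ea eb.
  by rewrite -subr_ge0 (_ : _ - _ = (x * t - y * z) ^+ 2) ?sqr_ge0 //; ring.
rewrite -(@ler_pXn2r _ 2) ?nnegrE ?addr_ge0 // ec [(a + b) ^+ 2]sqrrD.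
rewrite ea eb.
by move: cs; nra.
Qed.

Lemma dist_triangle v u w : enorm (u - w) <= enorm (u - v) + enorm (v - w).
Proof. by rewrite (le_trans _ (enorm2_triangle _ _)) // addrA subrK. Qed.

(** The image of [w] under the rotation by a right angle. *)
Definition perp w : 'rV[R]_2 := \row_k (if k == 0 then - w 0 1 else w 0 0).

Lemma sqr_enorm_perp_basis w (a b : R) :
  enorm (a *: w + b *: perp w) ^+ 2 = (a ^+ 2 + b ^+ 2) * enorm w ^+ 2.
Proof. rewrite !sqr_enorm2 !mxE /=; ring. Qed.

Lemma perp_basis w y :
  w != 0 -> exists a b, y = a *: w + b *: perp w.
Proof.
move=> w_neq0; have : enorm w ^+ 2 != 0.
  by rewrite sqrf_eq0; apply: contraNneq w_neq0 => /enorm_eq0 ->.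
rewrite sqr_enorm2 => nz; set d := _ + _ in nz.
exists ((y 0 0 * w 0 0 + y 0 1 * w 0 1) / d).
exists ((y 0 1 * w 0 0 - y 0 0 * w 0 1) / d).
by apply: row2P; rewrite !mxE /= /d; field.
Qed.

(** The candidates for the intersection of the circle of radius [r] around [u]
    with the circle of radius [s] around [v].  In the frame
    [w = v - u], [perp w], the difference of the two circle equations gives the
    coordinate [a] along [w], and either equation then gives the square of the
    transverse coordinate [b].  When that square is negative the circles do not
    meet, and [Num.sqrt] returns zero. *)
Definition circle_points u v r s : seq 'rV[R]_2 :=
  let w := v - u in
  let a := (r ^+ 2 - s ^+ 2 + enorm w ^+ 2) / (2 * enorm w ^+ 2) in
  let b := Num.sqrt (r ^+ 2 / enorm w ^+ 2 - a ^+ 2) in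
  [:: u + (a *: w + b *: perp w); u + (a *: w + (- b) *: perp w)].

Lemma mem_circle_points u v y :
  u != v -> y \in circle_points u v (enorm (y - u)) (enorm (y - v)).
Proof.
move=> uv; set w := v - u; have w_neq0 : w != 0 by rewrite subr_eq0 eq_sym.
have d_gt0 : 0 < enorm w ^+ 2 by rewrite exprn_gt0 // enorm_gt0 eq_sym.
have [a [b yuE]] := perp_basis (y - u) w_neq0.
have yvE : y - v = (a - 1) *: w + b *: perp w.
  by rewrite scalerBl scale1r addrAC -yuE /w opprB addrA subrK.
rewrite /circle_points -/w yvE yuE !sqr_enorm_perp_basis.
set d := enorm w ^+ 2 in d_gt0 *; have d_neq0 : d != 0 by rewrite gt_eqF.
have -> : ((a ^+ 2 + b ^+ 2) * d - ((a - 1) ^+ 2 + b ^+ 2) * d + d) / (2 * d)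
  = a by field.
have -> : (a ^+ 2 + b ^+ 2) * d / d - a ^+ 2 = b ^+ 2 by field.
rewrite sqrtr_sqr !inE -(subrK u y) yuE ![u + _]addrC.
case: (ger0P b) => _; rewrite ?opprK.
  by rewrite eqxx.
by rewrite eqxx orbT.
Qed.

(** For equal radii [r] the common points lie on the perpendicular bisector, and
    there are two of them as soon as [r] exceeds half the distance of the
    centres. *)
Lemma isosceles_circle_points u v r :
    0 < enorm (u - v) < 2 * r ->
  uniq (circle_points u v r r) /\
  {in circle_points u v r r, forall y, enorm (y - u) = r /\ enorm (y - v) = r}.
Proof.
rewrite enormB => /andP[d_gt0 d_lt]; set w := v - u in d_gt0 d_lt *.
have r_gt0 : 0 < r by lra.
have dd_gt0 : 0 < enorm w ^+ 2 by rewrite exprn_gt0.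
have d_neq0 : enorm w != 0 by rewrite gt_eqF.
rewrite /circle_points -/w.
have -> : (r ^+ 2 - r ^+ 2 + enorm w ^+ 2) / (2 * enorm w ^+ 2) = 1 / 2.
  by field.
set h := r ^+ 2 / enorm w ^+ 2 - (1 / 2) ^+ 2.
have h_gt0 : 0 < h by rewrite subr_gt0 ltr_pdivlMr //; nra.
have sqrt_h_gt0 : 0 < Num.sqrt h by rewrite sqrtr_gt0.
have sqr_sqrt_h : Num.sqrt h ^+ 2 = h by rewrite sqr_sqrtr ?ltW.
split.
  rewrite /= inE andbT.
  apply/eqP => /addrI/addrI/eqP; rewrite -subr_eq0 -scalerBl opprK => /eqP e.
  have := sqr_enorm_perp_basis w 0 (Num.sqrt h + Num.sqrt h).
  rewrite scale0r add0r e enorm0; move: sqrt_h_gt0 dd_gt0; nra.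
have on_circles y (b : R) : b ^+ 2 = h ->
    y = u + ((1 / 2) *: w + b *: perp w) ->
    enorm (y - u) = r /\ enorm (y - v) = r.
  move=> bE ->; split; apply: eq_enorm2; rewrite ?(ltW r_gt0) //.
    by rewrite addrC addKr sqr_enorm_perp_basis bE /h; field.
  have -> : u + ((1 / 2) *: w + b *: perp w) - v
      = (1 / 2 - 1) *: w + b *: perp w.
    by rewrite scalerBl scale1r {4}/w; apply: row2P; rewrite !mxE; ring.
  by rewrite sqr_enorm_perp_basis bE /h; field.
by move=> y; rewrite !inE => /orP[] /eqP; apply: on_circles; rewrite ?sqrrN.
Qed.

End EuclideanPlane.

(** * Rigid motions *)

Section RigidMotions.
Variable R : realType.

Lemma det_mx2 (A : 'M[R]_2) : \det A = A 0 0 * A 1 1 - A 0 1 * A 1 0.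
Proof.
rewrite (expand_det_row _ 0) sum_ord2 /cofactor !det_mx11 !mxE /= expr0 expr1.
have -> : lift (0 : 'I_2) 0 = 1 by apply/val_inj.
have -> : lift (1 : 'I_2) 0 = 0 by apply/val_inj.
by ring.
Qed.

Lemma rigid_motion_id d : rigid_motion (@id 'rV[R]_d).
Proof.
split=> //; exists 1%:M, 0; split; last by rewrite det1.
by move=> x; rewrite mulmx1 addr0.
Qed.

Lemma rigid_motion_comp d (f g : 'rV[R]_d -> 'rV[R]_d) :
  rigid_motion f -> rigid_motion g -> rigid_motion (g \o f).
Proof.
move=> [fiso [A [b [fE A_gt0]]]] [giso [B [c [gE B_gt0]]]]; split.
  by move=> x y /=; rewrite giso fiso.
exists (A *m B), (b *m B + c); rewrite det_mulmx mulr_gt0 //; split=> // x /=.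
by rewrite gE fE mulmxDl mulmxA addrA.
Qed.

Lemma rigid_motion_inv d (f : 'rV[R]_d -> 'rV[R]_d) : rigid_motion f ->
  exists g, [/\ rigid_motion g, cancel f g & cancel g f].
Proof.
move=> [fiso [A [b [fE A_gt0]]]].
have A_unit : A \in unitmx by rewrite unitmxE unitfE gt_eqF.
pose g (x : 'rV[R]_d) := (x - b) *m invmx A.
have fK : cancel f g by move=> x; rewrite /g fE addrK mulmxK.
have gK : cancel g f by move=> x; rewrite /g fE mulmxKV // subrK.
exists g; split=> //; split; first by move=> x y; rewrite -fiso !gK.
exists (invmx A), (- (b *m invmx A)); rewrite det_inv invr_gt0; split=> // x.
by rewrite /g mulmxBl.
Qed.

Lemma congruence_class_comp (V : finType) d (f : 'rV[R]_d -> 'rV[R]_d)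
    (p : V -> 'rV[R]_d) :
  rigid_motion f -> congruence_class (f \o p) = congruence_class p.
Proof.
move=> f_rigid; apply/seteqP; split=> q [g [g_rigid ->]].
  by exists (g \o f); split=> //; exact: rigid_motion_comp.
have [h [h_rigid fK _]] := rigid_motion_inv f_rigid.
exists (g \o h); split; first exact: rigid_motion_comp.
by apply/funext => v /=; rewrite fK.
Qed.

(** Translate [u] to the origin, then rotate; for [w = v - u] the matrix acting
    on row vectors has rows [(w0, - w1) / d] and [(w1, w0) / d]. *)
Lemma rigid_motion_to_axis (u v : 'rV[R]_2) : u != v ->
  exists f, [/\ rigid_motion f, f u = 0 & f v = enorm (u - v) *: delta_mx 0 0].
Proof.
rewrite -enorm_gt0 enormB.
(* [w] is kept opaque so that expanding matrix entries does not unfold it *)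
have [w wE] : {w | w = v - u} by exists (v - u).
rewrite -wE; set d := enorm w => d_gt0.
have d_neq0 : d != 0 by rewrite gt_eqF.
have dE : w 0 0 ^+ 2 + w 0 1 ^+ 2 = d ^+ 2 by rewrite -sqr_enorm2.
pose A : 'M[R]_2 := d^-1 *: \matrix_(i, j)
  (if i == j then w 0 0 else if i == 0 then - w 0 1 else w 0 1).
have mulA (x : 'rV[R]_2) : x *m A = d^-1 *: \row_j
    (if j == 0 then x 0 0 * w 0 0 + x 0 1 * w 0 1
               else x 0 1 * w 0 0 - x 0 0 * w 0 1).
  by apply: row2P; rewrite !mxE sum_ord2 !mxE /=; ring.
have detA : \det A = 1.
  rewrite det_mx2 !mxE /= -[RHS](divff (_ : d ^+ 2 != 0)) ?expf_neq0 // -{1}dE.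
  by field.
exists (fun x => (x - u) *m A); split.
- split=> [x y|]; last first.
    exists A, (- (u *m A)); rewrite detA ltr01; split=> // x.
    by rewrite mulmxBl.
  rewrite -mulmxBl opprB addrA subrK mulA; apply: eq_enorm2.
    by rewrite enorm_ge0.
  rewrite !sqr_enorm2 !mxE /=; set a := x 0 0 - _; set b := x 0 1 - _.
  transitivity ((a ^+ 2 + b ^+ 2) * (w 0 0 ^+ 2 + w 0 1 ^+ 2) / d ^+ 2).
    by field.
  by rewrite dE mulfK // expf_neq0.
- by rewrite subrr mul0mx.
- rewrite -wE mulA; apply: row2P; rewrite !mxE /=.
    by rewrite -!expr2 dE; field.
  by field.
Qed.

(** The other isometry fixing two points is the reflection in the line through
    them; it is ruled out by the sign of the determinant.  The second row of the
    matrix is found by preserving the norms of [(0, 1)] and [(1, 1)]. *)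
Lemma rigid_motion_fix_axis (f : 'rV[R]_2 -> 'rV[R]_2) (c : R) :
    rigid_motion f -> c != 0 -> f 0 = 0 ->
    f (c *: delta_mx 0 0) = c *: delta_mx 0 0 ->
  f = id.
Proof.
move=> [fiso [A [b [fE A_gt0]]]] c_neq0 f0 fc.
have b0 : b = 0 by rewrite -f0 fE mul0mx add0r.
have {}fE x : f x = x *m A by rewrite fE b0 addr0.
have norm_f x : enorm (x *m A) = enorm x.
  by have := fiso x 0; rewrite !fE mul0mx !subr0.
have row0 : delta_mx 0 0 *m A = delta_mx 0 0 :> 'rV_2.
  by apply: (scalerI c_neq0); rewrite scalemxAl -fE.
have entry i j : A i j = (delta_mx 0 i *m A : 'rV_2) 0 j by rewrite -rowE mxE.
have A00 : A 0 0 = 1 by rewrite entry row0 mxE.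
have A01 : A 0 1 = 0 by rewrite entry row0 mxE.
have norm_row1 : A 1 0 ^+ 2 + A 1 1 ^+ 2 = 1.
  by rewrite !(entry 1) -sqr_enorm2 norm_f sqr_enorm2 !mxE /=; ring.
have norm_sum : (1 + A 1 0) ^+ 2 + A 1 1 ^+ 2 = 2.
  have := congr1 (fun t => t ^+ 2) (norm_f (delta_mx 0 0 + delta_mx 0 1)).
  rewrite /= !sqr_enorm2 mulmxDl row0 -rowE !mxE /=; lra.
rewrite det_mx2 A00 A01 in A_gt0.
have A10 : A 1 0 = 0 by nra.
have A11 : A 1 1 = 1 by nra.
suff A1 : A = 1%:M by apply/funext => x; rewrite fE A1 mulmx1.
apply/matrixP => i j; rewrite !mxE.
by case: (ord2P i) => ->; case: (ord2P j) => ->.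
Qed.

End RigidMotions.

(** * Henneberg I graphs as graphs built from an edge *)

Section EdgeConstruction.
Variable V : finType.

(** Starting from the edge [a b] rather than from a triangle makes the base case
    rigid (one pinned embedding) and every later vertex a doubling step; the
    edge is a parameter because embeddings are pinned along it. *)
Inductive edge_built (a b : V) : {set V} -> {set {set V}} -> Prop :=
| edge_built_edge of a != b :
    edge_built a b [set a; b]%SET [set [set a; b]]%SET
| edge_built_step (W : {set V}) (E : {set {set V}}) (x c d : V) of
    edge_built a b W E & x \notin W & c \in W & d \in W & c != d :
    edge_built a b (x |: W)%SET ([set x; c] |: ([set x; d] |: E))%SET.

Lemma henneberg1_edge_built (W : {set V}) (E : {set {set V}}) :
  henneberg1 W E -> exists a b, edge_built a b W E.
Proof.
elim=> [a b c ab bc ac|{}W {}E x c d _ [a [b built]] xW cW dW cd]; last first.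
  by exists a, b; exact: edge_built_step.
exists a, b.
have -> : [set a; b; c]%SET = (c |: [set a; b])%SET by rewrite finset.setUC.
have -> : [set [set a; b]; [set b; c]; [set a; c]]%SET =
          ([set c; a] |: ([set c; b] |: [set [set a; b]]))%SET.
  rewrite (finset.setUC [set c]%SET [set a]%SET) (finset.setUC [set c]%SET).
  by apply/setP => e; rewrite !inE; do 3!case: (e == _).
apply: edge_built_step; rewrite ?inE ?eqxx ?orbT //.
  exact: edge_built_edge.
by rewrite negb_or ![c == _]eq_sym ac bc.
Qed.

Lemma edge_built_base (a b : V) W E : edge_built a b W E ->
  [/\ a \in W, b \in W, a != b & [set a; b]%SET \in E].
Proof.
elim=> [ab|{}W {}E x c d _ [aW bW ab abE] _ _ _ _].
  by rewrite !inE !eqxx orbT.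
by rewrite !inE aW bW abE !orbT.
Qed.

Lemma edge_built_subset (a b : V) W E : edge_built a b W E ->
  forall e, e \in E -> e \subset W.
Proof.
elim=> [_ e|{}W {}E x c d _ IH _ cW dW _ e]; first by rewrite inE => /eqP ->.
rewrite !inE => /orP[/eqP->|/orP[/eqP->|/IH eW]].
- by rewrite finset.setUS // finset.sub1set.
- by rewrite finset.setUS // finset.sub1set.
- by rewrite (fintype.subset_trans eW) // finset.subsetUr.
Qed.

Lemma edge_built_card (a b : V) W E x :
  edge_built a b W E -> x \notin W ->
  (2 ^ (#|x |: W| - 2) = 2 ^ (#|W| - 2) * 2)%N.
Proof.
move=> built xW; have [aW bW ab _] := edge_built_base built.
have W_ge2 : (2 <= #|W|)%N.
  have <- : #|[set a; b]%SET| = 2%N by rewrite cards2 ab.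
  by rewrite subset_leq_card // finset.subUset !finset.sub1set aW bW.
by rewrite cardsU1 xW add1n subSn // expnSr.
Qed.

End EdgeConstruction.

(** * Pinned embeddings and their extension by one vertex *)

Section Embeddings.
Variables (R : realType) (V : finType).
Implicit Types (W : {set V}) (E : {set {set V}}) (l : {set V} -> R).

Lemma embeddings_agree d W E l (p q : V -> 'rV[R]_d) :
    (forall e, e \in E -> e \subset W) -> {in W, p =1 q} ->
  embeddings E d l p -> embeddings E d l q.
Proof.
move=> EW pq p_emb i j ijE; have /fintype.subsetP ijW := EW _ ijE.
by rewrite -!pq ?p_emb // ijW // !inE eqxx ?orbT.
Qed.

Lemma eq_embeddings d E l l' : {in E, l =1 l'} ->
  embeddings E d l = embeddings E d l' :> set (V -> 'rV[R]_d).
Proof.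
move=> ll'; apply/seteqP; split=> p p_emb i j ijE; first by rewrite -ll' ?p_emb.
by rewrite ll' ?p_emb.
Qed.

Lemma embeddingsU1 d E l u v (p : V -> 'rV[R]_d) :
  embeddings ([set u; v] |: E)%SET d l p <->
  enorm (p u - p v) = l [set u; v]%SET /\ embeddings E d l p.
Proof.
split=> [p_emb | [puv p_emb] i j].
  by split=> [|i j ijE]; apply: p_emb; rewrite !inE ?eqxx ?ijE ?orbT.
rewrite !inE => /orP[/eqP ij_uv|]; last exact: p_emb.
rewrite ij_uv -puv.
have : v \in [set i; j]%SET by rewrite ij_uv !inE eqxx orbT.
have : u \in [set i; j]%SET by rewrite ij_uv !inE eqxx.
have : j \in [set u; v]%SET by rewrite -ij_uv !inE eqxx orbT.
have : i \in [set u; v]%SET by rewrite -ij_uv !inE eqxx.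
rewrite !inE => /orP[]/eqP-> /orP[]/eqP-> //; rewrite ?orbb.
- by move=> _ /eqP->.
- by rewrite enormB.
- by move=> /eqP->.
Qed.

Lemma embeddings_edge d (a b : V) l (p : V -> 'rV[R]_d) :
  embeddings [set [set a; b]]%SET d l p <-> enorm (p a - p b) = l [set a; b]%SET.
Proof.
rewrite -(finset.setU0 [set [set a; b]]%SET) embeddingsU1.
by split=> [[] //|pab]; split=> // i j; rewrite inE.
Qed.

Definition place (p : V -> 'rV[R]_2) x y : V -> 'rV[R]_2 :=
  fun v => if v == x then y else p v.

Lemma place_id p x y : place p x y x = y.
Proof. by rewrite /place eqxx. Qed.

Lemma place_neq p x y v : v != x -> place p x y v = p v.
Proof. by rewrite /place => /negPf ->. Qed.

Lemma place_in W p x y v : x \notin W -> v \in W -> place p x y v = p v.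
Proof. by move=> xW vW; rewrite place_neq //; apply: contraNneq xW => <-. Qed.

(** During the construction the graph lives on [W] but its embeddings are
    functions on all of [V]; they are normalized to vanish off [W], so that a
    pinned embedding is counted once and not once for each set of values off
    [W]. *)
Definition pinned (a b : V) W E l : set (V -> 'rV[R]_2) :=
  [set p | [/\ embeddings E 2 l p, p a = 0,
               p b = l [set a; b]%SET *: delta_mx 0 0 &
               forall v, v \notin W -> p v = 0]].

Lemma pinned_step (a b : V) W E l x c d (p : V -> 'rV[R]_2) :
    edge_built a b W E -> x \notin W -> c \in W -> d \in W ->
  pinned a b (x |: W)%SET ([set x; c] |: ([set x; d] |: E))%SET l p <->
  exists q, [/\ pinned a b W E l q, p = place q x (p x),
    enorm (p x - q c) = l [set x; c]%SET & enorm (p x - q d) = l [set x; d]%SET].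
Proof.
move=> built xW cW dW; have [aW bW _ _] := edge_built_base built.
have sub := edge_built_subset built.
split=> [[/embeddingsU1[pxc /embeddingsU1[pxd p_emb]] pa pb poff]|].
  exists (place p x 0); split.
  - split; rewrite ?(place_in _ _ xW) //.
      by apply: (embeddings_agree sub _ p_emb) => v vW; rewrite (place_in _ _ xW).
    move=> v vW; rewrite /place; case: eqVneq => // vx.
    by apply: poff; rewrite !inE negb_or vx.
  - by apply/funext => v; rewrite /place; case: eqVneq => // ->.
  - by rewrite (place_in _ _ xW).
  - by rewrite (place_in _ _ xW).
move=> [q [[q_emb qa qb qoff] pE pxc pxd]].
have pq v : v \in W -> p v = q v by move=> vW; rewrite pE (place_in _ _ xW).
split; rewrite ?pq //.
  apply/embeddingsU1; split; first by rewrite (pq c).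
  apply/embeddingsU1; split; first by rewrite (pq d).
  by apply: (embeddings_agree sub _ q_emb) => v vW; rewrite pq.
by move=> v; rewrite !inE negb_or => /andP[vx vW]; rewrite pE place_neq ?qoff.
Qed.

Lemma pinned_edge (a b : V) l : a != b -> 0 <= l [set a; b]%SET ->
  pinned a b [set a; b]%SET [set [set a; b]]%SET l =
  [set` [:: place (fun=> 0) b (l [set a; b]%SET *: delta_mx 0 0)]].
Proof.
move=> ab l_ge0; have ba : b == a = false by rewrite eq_sym (negPf ab).
apply/seteqP; split=> p /=; rewrite inE.
  move=> [_ pa pb poff]; apply/eqP/funext => v; rewrite /place.
  case: eqVneq => [-> //|vb]; have [-> //|va] := eqVneq v a.
  by apply: poff; rewrite !inE negb_or va.
move=> /eqP ->; split; rewrite ?place_id ?place_neq //.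
  apply/embeddings_edge; rewrite place_id place_neq // enormB subr0.
  by apply: eq_enorm2; rewrite // sqr_enorm2 !mxE /= mulr1 mulr0; ring.
by move=> v; rewrite !inE negb_or => /andP[_ vb]; rewrite place_neq.
Qed.

Definition extensions (s : seq (V -> 'rV[R]_2)) x c d l :=
  [seq place q x y | q <- s,
    y <- circle_points (q c) (q d) (l [set x; c]%SET) (l [set x; d]%SET)].

Lemma size_extensions s x c d l : size (extensions s x c d l) = (size s * 2)%N.
Proof.
by rewrite size_allpairs_dep; elim: s => //= q s ->; rewrite mulSn.
Qed.

(** * Counting pinned embeddings *)

(** If [q c = q d] then the new vertex is at the same distance from both, so its
    two edges have equal lengths; injectivity of [l] excludes this, and the new
    vertex lies on two circles with distinct centres. *)
Lemma pinned_le (a b : V) W E l : edge_built a b W E ->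
    positive_lengths E l -> {in E &, injective l} ->
  exists s, size s = (2 ^ (#|W| - 2))%N /\ pinned a b W E l `<=` [set` s].
Proof.
elim=> [ab|{}W {}E x c d built IH xW cW dW cd] l_gt0 l_inj.
  rewrite pinned_edge ?ltW ?l_gt0 ?inE //.
  exists [:: place (fun=> 0) b (l [set a; b]%SET *: delta_mx 0 0)].
  by split; first by rewrite cards2 ab.
case: IH => [e eE|e f eE fE|s [s_size pinned_s]].
- by apply: l_gt0; rewrite !inE eE !orbT.
- by apply: l_inj; rewrite !inE ?eE ?fE !orbT.
exists (extensions s x c d l); split.
  by rewrite size_extensions s_size (edge_built_card built).
move=> p /(pinned_step _ _ built xW cW dW)[q [/pinned_s qs pE pxc pxd]].
apply/allpairsPdep; exists q, (p x); split; [exact: qs| |exact: pE].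
rewrite -pxc -pxd; apply: mem_circle_points.
apply/negP => /eqP qcd; have : [set x; c]%SET = [set x; d]%SET.
  by apply: l_inj; rewrite ?inE ?eqxx ?orbT // -pxc -pxd qcd.
move/setP/(_ c); rewrite !inE eqxx orbT (negPf cd) orbF => /esym/eqP cx.
by rewrite -cx cW in xW.
Qed.

(** The bound on distances between vertices of [W], uniform in the embedding, is
    what lets the next two equal lengths be chosen large for all the embeddings
    at once: with length [D + 1], the new vertex is at distance between [1] and
    [2 * D + 1] from each earlier one, and the circles around [c] and [d], whose
    centres are at most [D] apart, meet in two points. *)
Lemma exists_exact_lengths (a b : V) W E : edge_built a b W E ->
  exists (l : {set V} -> R) (D : R) (s : seq (V -> 'rV[R]_2)),
    [/\ positive_lengths E l,
        forall p, embeddings E 2 l p -> {in W &, forall i j, i != j ->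
          0 < enorm (p i - p j) <= D},
        uniq s, size s = (2 ^ (#|W| - 2))%N & pinned a b W E l = [set` s]].
Proof.
elim=> [ab|{}W {}E x c d built [l [D [s [l_gt0 D_bound s_uniq s_size s_eq]]]]
           xW cW dW cd].
  exists (fun=> 1), 1, [:: place (fun=> 0) b (1 *: delta_mx 0 0)].
  split; rewrite ?cards2 ?ab ?pinned_edge //.
  move=> p /embeddings_edge pab i j; rewrite !inE.
  by move=> /orP[]/eqP-> /orP[]/eqP->; rewrite ?eqxx // 1?[enorm (p b - _)]enormB
     pab ltr01 lexx.
have [aW bW ab abE] := edge_built_base built.
have D_gt0 : 0 < D.
  (* [D] bounds the distance of [a] and [b] in an embedding, and [s] has one *)
  have [q qs] : exists q, q \in s.
    have : (0 < size s)%N by rewrite s_size expn_gt0.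
    by case: (s) => // q t _; exists q; rewrite inE eqxx.
  have [q_emb _ _ _] : pinned a b W E l q by rewrite s_eq.
  by have /andP[/lt_le_trans lt /lt] := D_bound q q_emb a b aW bW ab.
pose l' (e : {set V}) := if x \in e then D + 1 else l e.
have l'E e : e \in E -> l e = l' e.
  move=> /(edge_built_subset built)/fintype.subsetP eW; rewrite /l' ifN //.
  by apply: contra xW; exact: eW.
have l'xc : l' [set x; c]%SET = D + 1 by rewrite /l' !inE eqxx.
have l'xd : l' [set x; d]%SET = D + 1 by rewrite /l' !inE eqxx.
have pinned_l' : pinned a b W E l = pinned a b W E l'.
  by rewrite /pinned (eq_embeddings 2 l'E) l'E.
have apart q : q \in s -> 0 < enorm (q c - q d) < 2 * (D + 1).
  move=> qs; have [q_emb _ _ _] : pinned a b W E l q by rewrite s_eq.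
  by have /andP[-> le] := D_bound q q_emb c d cW dW cd; lra.
exists l', (2 * D + 1), (extensions s x c d l'); split.
- move=> e; rewrite !inE /l'; case: ifP => [_ _|xe]; first by lra.
  by case/orP=> [/eqP e_eq|/orP[/eqP e_eq|/l_gt0 //]]; move: xe;
     rewrite e_eq !inE eqxx.
- move=> p /embeddingsU1[pxc /embeddingsU1[pxd p_emb]].
  rewrite -(eq_embeddings 2 l'E) in p_emb; have {D_bound} D_bound := D_bound p p_emb.
  have new_far w : w \in W -> 0 < enorm (p x - p w) <= 2 * D + 1.
    move=> wW; have := dist_triangle (p w) (p x) (p c).
    have := dist_triangle (p c) (p x) (p w); rewrite pxc l'xc.
    have [->|wc] := eqVneq w c; first by rewrite pxc l'xc; lra.
    rewrite [enorm (p c - p w)]enormB.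
    by have /andP[] := D_bound w c wW cW wc; lra.
  move=> i j; rewrite !inE => /orP[/eqP->|iW] /orP[/eqP->|jW] ij.
  + by rewrite eqxx in ij.
  + exact: new_far.
  + by rewrite enormB new_far.
  + by have /andP[] := D_bound i j iW jW ij; lra.
- apply: allpairs_uniq_dep => //.
    by move=> q /apart/isosceles_circle_points[]; rewrite l'xc l'xd.
  move=> _ _ /allpairsPdep[q [y [qs _ ->]]] /allpairsPdep[q' [y' [qs' _ ->]]] /= e.
  have yy' : y = y' by rewrite -(place_id q x y) e place_id.
  suff qq' : q = q' by rewrite qq' yy'.
  apply/funext => v; have [->|vx] := eqVneq v x.
    have [_ _ _ ->] // : pinned a b W E l q by rewrite s_eq.
    by have [_ _ _ ->] // : pinned a b W E l q' by rewrite s_eq.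
  by rewrite -(place_neq q y vx) e place_neq.
- by rewrite size_extensions s_size (edge_built_card built).
- apply/seteqP; split=> p.
    move=> /(pinned_step _ _ built xW cW dW)[q []].
    rewrite -pinned_l' s_eq => qs pE pxc pxd.
    apply/allpairsPdep; exists q, (p x); split; [exact: qs| |exact: pE].
    rewrite -pxc -pxd mem_circle_points // -enorm_gt0.
    by have /andP[] := apart q qs.
  move=> /allpairsPdep[q [y [qs y_on ->]]].
  apply/(pinned_step _ _ built xW cW dW); exists q.
  rewrite place_id l'xc l'xd in y_on *; split=> //; first by rewrite -pinned_l' s_eq.
    by have [_ /(_ y y_on)[]] := isosceles_circle_points (apart q qs).
  by have [_ /(_ y y_on)[]] := isosceles_circle_points (apart q qs).
Qed.

End Embeddings.

(** * From pinned embeddings to classes *)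

Section Classes.
Variable R : realType.

Lemma embeddings_rigid_motion (V : finType) (E : {set {set V}}) d l
    (f : 'rV[R]_d -> 'rV[R]_d) p :
  rigid_motion f -> embeddings E d l p -> embeddings E d l (f \o p).
Proof. by move=> [fiso _] p_emb i j ijE; rewrite /= fiso p_emb. Qed.

Lemma embeddings_mod_rigid_pinned (V : finType) (a b : V) (E : {set {set V}})
    (l : {set V} -> R) :
    edge_built a b [set: V]%SET E -> positive_lengths E l ->
  embeddings_mod_rigid E 2 l =
  @congruence_class R V 2 @` pinned a b [set: V]%SET E l.
Proof.
move=> built l_gt0; have [_ _ _ abE] := edge_built_base built.
apply/seteqP; split=> _ [p p_in <-]; last by exists p => //; have [] := p_in.
have pab := p_in a b abE.
have [|f [f_rigid fa fb]] := @rigid_motion_to_axis R (p a) (p b).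
  by rewrite -enorm_gt0 pab l_gt0.
exists (f \o p); last exact: congruence_class_comp.
split=> //=; first exact: embeddings_rigid_motion.
  by rewrite fb pab.
by move=> v; rewrite inE.
Qed.

Lemma congruence_class_pinned_inj (V : finType) (a b : V) W
    (E : {set {set V}}) (l : {set V} -> R) : 0 < l [set a; b]%SET ->
  {in pinned a b W E l &, injective (@congruence_class R V 2)}.
Proof.
move=> l_gt0 p q; rewrite !inE => -[_ pa pb _] [_ qa qb _] pq.
have [f [f_rigid qE]] : congruence_class p q.
  by rewrite pq; exists id; split=> //; exact: rigid_motion_id.
rewrite qE (@rigid_motion_fix_axis R f (l [set a; b]%SET)) ?gt_eqF //.
  by move: qa; rewrite qE /= pa.
by move: qb; rewrite qE /= pb.
Qed.

(** * Genericity *)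

(** The exceptional set is the zero set of a single polynomial, the product of
    the differences [X_i - X_j] over ordered pairs of distinct indices. *)
Lemma generically_injective (V : finType) (E : {set {set V}})
    (Q : ({set V} -> R) -> Prop) :
    (forall l, positive_lengths E l -> {in E &, injective l} -> Q l) ->
  generically E Q.
Proof.
move=> inj_Q; set k := #|E|.
pose X (i : 'I_k) : mpoly.mpoly k R := mpoly.mpolyX R (mpoly.mnm1 i).
pose disc : mpoly.mpoly k R :=
  \prod_(e : 'I_k * 'I_k | e.1 != e.2) (X e.1 - X e.2).
have discE x : mpoly.meval x disc =
    \prod_(e : 'I_k * 'I_k | e.1 != e.2) (x e.1 - x e.2).
  by rewrite rmorph_prod; apply: eq_bigr => e _; rewrite rmorphB /= !mpoly.mevalXU.
exists [set x | mpoly.meval x disc = 0]; split.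
- exists [set disc]; apply/seteqP; split=> x /= => [x0 p -> //|]; exact.
(* the point with coordinates 0, 1, 2, ... is off the zero set *)
- move/seteqP => [_ /(_ (fun i => (i : nat)%:R) I)] /=; rewrite discE.
  apply/eqP/prodf_neq0 => -[i j] /= ij.
  by rewrite subr_eq0 eqr_nat.
- move=> l l_gt0 /= /eqP; rewrite discE => disc_neq0.
  apply: inj_Q => // e f eE fE lef.
  apply: contraNeq disc_neq0 => ef.
  apply/prodf_eq0.
  exists (enum_rank_in eE e, enum_rank_in eE f) => /=.
    by apply: contra ef => /eqP/enum_rank_in_inj ->.
  by rewrite /squared_lengths !enum_rankK_in // lef subrr.
Qed.

End Classes.

(** * Counting the classes *)

Lemma card_uniq_seq (T : eqType) (s : seq T) :
  uniq s -> [set` s] #= `I_(size s).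
Proof.
elim: s => [_|x s IH /= /andP[xs /IH s_card]].
  by rewrite set_nil II0 card_eq00.
apply/eq_cardSP; exists x; first by rewrite /= inE eqxx.
suff -> : [set` x :: s] `\ x = [set` s] by [].
apply/seteqP; split=> y /=; rewrite inE.
  by move=> [/orP[/eqP->|//] []].
by move=> ys; rewrite ys orbT; split=> // yx; rewrite -yx ys in xs.
Qed.

Lemma card_le_seq (T : eqType) (s : seq T) : [set` s] #<= `I_(size s).
Proof.
have -> : [set` s] = [set` undup s].
  by apply/seteqP; split=> x /=; rewrite mem_undup.
by rewrite (card_le_eql (card_uniq_seq (undup_uniq s))) card_le_II size_undup.
Qed.

Theorem proposition5p2 (R : realType) (n : nat) (hn : (3 <= n)%N)
    (E : {set {set 'I_n}}) (hG : henneberg1 [set: 'I_n]%SET E) :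
  generically (R := R) E (fun l => realizable E 2 l ->
    embeddings_mod_rigid E 2 l #<= `I_(2 ^ (n - 2))) /\
  (exists l : {set 'I_n} -> R, positive_lengths E l /\
    embeddings_mod_rigid E 2 l #= `I_(2 ^ (n - 2))).
Proof.
have [a [b built]] := henneberg1_edge_built hG.
split.
  apply: generically_injective => l l_gt0 l_inj _.
  have [s [s_size pinned_s]] := pinned_le built l_gt0 l_inj.
  rewrite cardsT card_ord in s_size.
  rewrite (embeddings_mod_rigid_pinned built l_gt0) -s_size.
  apply: card_le_trans (card_image_le _ _) _.
  exact: card_le_trans (subset_card_le pinned_s) (card_le_seq s).
have [l [D [s [l_gt0 _ s_uniq s_size s_eq]]]] := exists_exact_lengths R built.
rewrite cardsT card_ord in s_size.
have [_ _ _ abE] := edge_built_base built.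
exists l; split=> //; rewrite (embeddings_mod_rigid_pinned built l_gt0) -s_size.
have inj := congruence_class_pinned_inj (W := [set: 'I_n]%SET) (E := E)
  (l_gt0 _ abE).
apply: card_eq_trans (inj_card_eq inj) _.
by rewrite s_eq; exact: card_uniq_seq.
Qed.
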